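(* Let $\mathsf{k}$ be a field of characteristic zero, $S=\mathsf{k}[x,y,z]$, $R=\mathsf{k}[X,Y,Z]$ with $S$ acting by differentiation. Let $F\in R$ be nonzero homogeneous of odd degree $d\ge3$, $A=S/\operatorname{Ann}_S(F)$, and $\ell\in S_1$ with $\ell^2\ne0$ and $\ell^3=0$ in $A$. Set $(r,s,t)=(h_{A^{(2)}}(\frac{d-1}2),h_{A^{(1)}}(\frac{d-1}2),h_A(\frac{d-1}2))$. Then: (1) If $d\ge5$, $r\in[1,\frac{d-1}2-1]$, $s\in[2r,\frac{d-1}2+r]$ and $t\in[2s-r,\frac{d-1}2+s+1]$, then $h_{A^{(2)}}(i)=i+1$ for $0\le i\le r-1$ and $h_{A^{(2)}}(i)=r$ for $r\le i\le\frac{d-1}2$; $h_{A^{(1)}}(i)=2i+1$ for $0\le i\le r-1$, $h_{A^{(1)}}(i)=i+r+1$ for $r\le i\le s-r-1$, $h_{A^{(1)}}(i)=s$ for $s-r\le i\le\frac{d-1}2$. If $t=3r$, then $h_A$ on $0\le i\le\frac{d-1}2$ is one of: (a) $h_A(0)=1$, $h_A(i)=3i$ for $1\le i\le r-1$, $h_A(i)=3r$ for $r\le i\le\frac{d-1}2$; or (b) $h_A(0)=1$, $h_A(i)=3i$ for $1\le i\le r-1$, $h_A(r)=3r-1$, $h_A(i)=3r$ for $r+1\le i\le\frac{d-1}2$. Otherwise: $h_A(0)=1$; $h_A(i)=3i$ for $1\le i\le r$; $h_A(i)=2i+r+1$ for $r+1\le i\le s-r-1$; at $i=s-r$, $h_A(i)=2i+r+1$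 if $t>2s-r$ and $s>2r$, and $h_A(i)=2i+r$ if $t>2s-r$ and $s=2r$; $h_A(i)=i+s+1$ for $s-r+1\le i\le t-s-1$; $h_A(i)=t$ for $t-s\le i\le\frac{d-1}2$. (2) If $d\ge3$, $r\in[1,\frac{d-1}2-1]$, $s=\frac{d-1}2+r+1$ and $t=d+r$, then $h_{A^{(1)}}(i)=2i+1$ for $0\le i\le r$ and $h_{A^{(1)}}(i)=i+1+r$ for $r+1\le i\le\frac{d-1}2$; and $h_A(0)=1$, $h_A(i)=3i$ for $1\le i\le r+1$, $h_A(i)=2i+1+r$ for $r+2\le i\le\frac{d-1}2$. (3) If $d\ge3$, $r=\frac{d-1}2$, $s\in[d-1,d]$ and $t\in[\frac{d-1}2+s-1,3\cdot\frac{d-1}2]$, then for every $i\in[0,\frac{d-1}2-1]$: $h_{A^{(2)}}(i)=i+1$, $h_{A^{(1)}}(i)=2i+1$, and $h_A(0)=1$, $h_A(i)=3i$ for $i\ge1$.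
   Context: $x,y,z$ act as $\partial/\partial X,\partial/\partial Y,\partial/\partial Z$; $\operatorname{Ann}_S(G)=\{g\in S:g\circ G=0\}$. $\ell^k=0$ in $A$ means $\ell^k\circ F=0$. $A^{(i)}:=S/\operatorname{Ann}_S(\ell^i\circ F)$; $h_B(j)=\dim_{\mathsf{k}}B_j$. Intervals $[a,b]$ denote sets of integers. *)

(* Defs.v *)
From HB Require Import structures.
From mathcomp Require Import all_boot all_order all_algebra.
From mathcomp Require Import mpoly.
From Stdlib Require Import ClassicalEpsilon.

Set Implicit Arguments.
Unset Strict Implicit.
Unset Printing Implicit Defensive.

Import GRing.Theory.
Local Open Scope ring_scope.

(* Both S = k[x,y,z] and R = k[X,Y,Z] are modelled by {mpoly k[3]};
   S acts on R by differentiation (x,y,z act as d/dX, d/dY, d/dZ):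
   for a monomial x^m, x^m o G = d^m G / dX^m, extended k-linearly. *)
Definition act (k : fieldType) (g G : {mpoly k[3]}) : {mpoly k[3]} :=
  \sum_(m <- msupp g) g@_m *: mderivm m G.

Definition Ann (k : fieldType) (G : {mpoly k[3]}) : pred {mpoly k[3]} :=
  fun g => act g G == 0.

Definition indep_mod_ann (k : fieldType) (G : {mpoly k[3]}) (j n : nat) : Prop :=
  exists g : 'I_n -> {mpoly k[3]},
    (forall i, g i \is j.-homog) /\
    (forall c : 'I_n -> k,
        (\sum_(i < n) c i *: g i) \in Ann G -> forall i, c i = 0).

Definition asbool (P : Prop) : bool :=
  if excluded_middle_informative P then true else false.

(* Hilbert function h_{S/Ann_S(G)}(j) = dim_k (S/Ann_S(G))_j
   = dim_k S_j/(Ann_S(G) ∩ S_j), the maximal size of a linearly independent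
   family in the quotient.  The max is taken over n <= (j+1)^3, which is
   harmless since dim_k S_j = binomial(j+2,2) <= (j+1)^3. *)
Definition hilb (k : fieldType) (G : {mpoly k[3]}) (j : nat) : nat :=
  (\max_(n < (j.+1 ^ 3).+1 | asbool (indep_mod_ann G j n)) n)%N.

(* Main.v *)
Require Import Defs.
From HB Require Import structures.
From mathcomp Require Import all_boot all_order all_algebra.
From mathcomp Require Import mpoly.
From mathcomp Require Import zify.
From mathcomp Require Import ssrcomplements.
From Stdlib Require Import ClassicalEpsilon.
Import GRing.Theory.

Set Implicit Arguments.
Unset Strict Implicit.
Unset Printing Implicit Defensive.

(* For a form [G] of degree [D], Gorenstein duality gives [h_G(i) = h_G(D - i)], and
   multiplication by [l] splits [h_G(i) = h_{l o G}(i - 1) + T_G(i)], where [T_G] is the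
   Hilbert function of [S / (Ann G + (l))], a quotient of a polynomial ring in two
   variables.  By Macaulay's bound in two variables [T_G(i) <= i + 1], and [T_G] is
   nonincreasing from the first [i] with [T_G(i) <= i] on.  For [F], [l o F] and
   [l^2 o F] the functions [T] are moreover pointwise ordered, and the last one is
   [h_{A^(2)}] itself since [l^3 o F = 0].  Together with the three symmetries these
   facts force [T_G(i) = min (i + 1, T_G((d-1)/2))] up to the middle degree, except that
   at [i = r] one value stays undetermined when [t = 3 r].

   A form [G] is encoded by its moments [m |-> (d^m G)(0)]; since the characteristic is
   zero, [h_G(j)] is the rank of the Hankel matrix [(m, m') |-> moment (m + m')] with
   [mdeg m = j], whose row space is the degree [D - j] part of the inverse system. *)

(** * Macaulay sequences in two variables *)

Section OSequence.
Local Open Scope nat_scope.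

Definition planar_oseq (D : nat) (T : nat -> nat) : Prop :=
  (forall i, i <= D -> T i <= i.+1) /\
  (forall i, i < D -> T i <= i -> T i.+1 <= T i).

Variables (D : nat) (T : nat -> nat).
Hypothesis oT : planar_oseq D T.

Lemma oseq_noninc i j : T i <= i -> i <= j <= D -> T j <= T i.
Proof.
move=> Ti; elim: j => [|j IH] /andP[]; first by rewrite leqn0 => /eqP ->.
rewrite leq_eqVlt => /orP[/eqP <- //|ij jD].
have Tj : T j <= T i by apply: IH; lia.
have := oT.2 j jD; lia.
Qed.

Lemma oseq_generic i j : i < T j -> i <= j <= D -> T i = i.+1.
Proof.
move=> iT ij; have := oT.1 i ltac:(lia); have := @oseq_noninc i j; lia.
Qed.

(** From [T j <= i <= j], [T] does not increase after [j], so [T i <= T j' <= T j <= i]; hence it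
    does not increase after [i] either. Used with [j] the middle degree and [j'] the reflection of
    [i]. *)
Lemma oseq_plateau i j j' :
  T j <= i -> i <= j -> j <= j' <= D -> T i <= T j' -> T i = T j.
Proof.
move=> Tj ij jj' Ti; have H1 := @oseq_noninc j j'; have H2 := @oseq_noninc i j.
lia.
Qed.

End OSequence.

(** * Numerical deduction of the Hilbert functions from growth and symmetry *)

Lemma hilbert_functions_of_cube_zero (e : nat) (h h1 h2 T T1 T2 : nat -> nat) :
  (0 < e)%N ->
  planar_oseq (2 * e + 1) T -> planar_oseq (2 * e) T1 ->
  planar_oseq (2 * e - 1) T2 ->
  (forall i, i <= 2 * e -> T1 i <= T i)%N ->
  (forall i, i <= 2 * e - 1 -> T2 i <= T1 i)%N ->
  (forall i, i <= 2 * e + 1 -> h (2 * e + 1 - i) = h i)%N ->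
  (forall i, i <= 2 * e -> h1 (2 * e - i) = h1 i)%N ->
  (forall i, i <= 2 * e - 1 -> h2 (2 * e - 1 - i) = h2 i)%N ->
  h 0%N = T 0%N -> (forall i, i <= 2 * e -> h i.+1 = T i.+1 + h1 i)%N ->
  h1 0%N = T1 0%N ->
  (forall i, i <= 2 * e - 1 -> h1 i.+1 = T1 i.+1 + h2 i)%N ->
  (forall i, i <= 2 * e - 1 -> h2 i = T2 i)%N ->
  let r := h2 e in
  let s := h1 e in
  let t := h e in
  ((1 <= r <= e - 1)%N -> (2 * r <= s <= e + r)%N ->
   (2 * s - r <= t <= e + s + 1)%N ->
     (forall i, (i <= r - 1)%N -> h2 i = i + 1)%N
  /\ (forall i, (r <= i <= e)%N -> h2 i = r)
  /\ (forall i, (i <= r - 1)%N -> h1 i = 2 * i + 1)%N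
  /\ (forall i, (r <= i <= s - r - 1)%N -> h1 i = i + r + 1)%N
  /\ (forall i, (s - r <= i <= e)%N -> h1 i = s)
  /\ (t = 3 * r ->
        (h 0 = 1
         /\ (forall i, (1 <= i <= r - 1)%N -> h i = 3 * i)%N
         /\ (forall i, (r <= i <= e)%N -> h i = 3 * r)%N)
     \/ (h 0 = 1
         /\ (forall i, (1 <= i <= r - 1)%N -> h i = 3 * i)%N
         /\ h r = (3 * r - 1)%N
         /\ (forall i, (r + 1 <= i <= e)%N -> h i = 3 * r)%N))%N
  /\ (t <> 3 * r ->
        h 0 = 1
     /\ (forall i, (1 <= i <= r)%N -> h i = 3 * i)%N
     /\ (forall i, (r + 1 <= i <= s - r - 1)%N -> h i = 2 * i + r + 1)%N
     /\ ((2 * s - r < t)%N -> (2 * r < s)%N ->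
           h (s - r)%N = (2 * (s - r) + r + 1)%N)
     /\ ((2 * s - r < t)%N -> s = (2 * r)%N ->
           h (s - r)%N = (2 * (s - r) + r)%N)
     /\ (forall i, (s - r + 1 <= i <= t - s - 1)%N -> h i = i + s + 1)%N
     /\ (forall i, (t - s <= i <= e)%N -> h i = t))%N)
  /\ ((1 <= r <= e - 1)%N -> s = (e + r + 1)%N -> t = (2 * e + 1 + r)%N ->
        (forall i, (i <= r)%N -> h1 i = 2 * i + 1)%N
     /\ (forall i, (r + 1 <= i <= e)%N -> h1 i = i + 1 + r)%N
     /\ h 0 = 1
     /\ (forall i, (1 <= i <= r + 1)%N -> h i = 3 * i)%N
     /\ (forall i, (r + 2 <= i <= e)%N -> h i = 2 * i + 1 + r)%N)
  /\ (r = e ->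
        forall i, (i <= e - 1)%N ->
          h2 i = (i + 1)%N /\ h1 i = (2 * i + 1)%N
          /\ h 0 = 1 /\ ((1 <= i)%N -> h i = (3 * i)%N)).
Proof.
move=> e0 oT oT1 oT2 T1T T2T1 sh sh1 sh2 h0 hS h10 h1S h2T r s t.
have rE : T2 e = r by rewrite -h2T //; lia.
(* Symmetry gives [h2 e = h2 (e - 1)], and [T2 (e - 1) <= e]. *)
have re : (r <= e)%N.
  have := oT2.1 e.-1 ltac:(lia); have := sh2 e ltac:(lia).
  have := h2T e.-1 ltac:(lia); rewrite -/r.
  by rewrite (_ : 2 * e - 1 - e = e.-1)%N; lia.
have h2lo i : (i < r)%N -> h2 i = i.+1.
  move=> ir; rewrite h2T; last by lia.
  by apply: (oseq_generic oT2 (j := e)); lia.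
have h2hi i : (r <= i.+1)%N -> (i <= e)%N -> h2 i = r.
  rewrite leq_eqVlt => /orP[/eqP ri _|ri ie']; first by rewrite h2lo; lia.
  have [->//|ie] := eqVneq i e.
  rewrite h2T -?rE; last by lia.
  apply: (oseq_plateau oT2 (j' := (2 * e - 1 - i)%N)); try lia.
  by rewrite -!h2T ?sh2; lia.
have T1lo i : (i < r)%N -> T1 i = i.+1.
  move=> ir; have := T2T1 i ltac:(lia); have := oT1.1 i ltac:(lia).
  have := h2T i ltac:(lia); have := h2lo i ir; lia.
have Tlo i : (i < r)%N -> T i = i.+1.
  move=> ir; have := T1T i ltac:(lia); have := oT.1 i ltac:(lia).
  have := T1lo i ir; lia.
have h1E i : (0 < i <= e)%N -> h1 i = (T1 i + h2 i.-1)%N.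
  by case: i => // i ie; rewrite h1S //=; lia.
have hE i : (0 < i <= e)%N -> h i = (T i + h1 i.-1)%N.
  by case: i => // i ie; rewrite hS //=; lia.
have h1lo i : (i < r)%N -> h1 i = (2 * i + 1)%N.
  move=> ir; have := T1lo i ir; case: i ir => [|i] ir; first by lia.
  by rewrite h1E /= ?h2lo; lia.
have hlo i : (0 < i < r)%N -> h i = (3 * i)%N.
  by move=> ir; rewrite hE ?h1lo ?Tlo; lia.
have h00 : (0 < r)%N -> h 0%N = 1%N by move=> r0; rewrite h0 Tlo.
have T1e : (T1 e + r)%N = s.
  have -> : s = (T1 e + h2 e.-1)%N by rewrite -h1E; lia.
  by rewrite h2hi; lia.
have T1mid i : (i < s - r)%N -> (i <= e)%N -> T1 i = i.+1.
  by move=> ir ie; apply: (oseq_generic oT1 (j := e)); lia.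
split; [|split].
- move=> r_e s_e t_e.
  (* Here [h2 (i - 1)] and [h2 i] both equal [r], so the symmetries of [h1] and [h2] give
     [T1 i = T1 (2 * e - i)], as the plateau lemma requires. *)
  have T1hi i : (s - r <= i <= e)%N -> T1 i = (s - r)%N.
    move=> ir; have [->|ie] := eqVneq i e; first by lia.
    have -> : (s - r)%N = T1 e by lia.
    apply: (oseq_plateau oT1 (j' := (2 * e - i)%N)); try lia.
    have := sh1 i ltac:(lia); rewrite (h1E i); last by lia.
    have -> : (2 * e - i)%N = (2 * e - i).-1.+1 by lia.
    rewrite h1S; last by lia.
    have -> : h2 (2 * e - i).-1 = h2 i.
      by rewrite -(sh2 i); [congr h2; lia | lia].
    by rewrite !h2hi; lia.
  have h1mid i : (r <= i < s - r)%N -> h1 i = (i + r + 1)%N.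
    move=> ir; rewrite h1E ?T1mid; try lia.
    have [ir1|ir1] := ltnP i.-1 r; first by rewrite h2lo; lia.
    by rewrite h2hi; lia.
  have h1hi i : (s - r <= i.+1)%N -> (r <= i <= e)%N -> h1 i = s.
    rewrite leq_eqVlt => /orP[/eqP si|si] ri; first by rewrite h1mid; lia.
    by rewrite h1E ?T1hi ?h2hi; lia.
  have h1e : h1 e.-1 = s by apply: h1hi; lia.
  have Te : (T e + s)%N = t by rewrite -h1e -hE //; lia.
  have Tmid i : (i < t - s)%N -> (i <= e)%N -> T i = i.+1.
    by move=> ir ie; apply: (oseq_generic oT (j := e)); lia.
  (* Symmetry gives [T i = T (2 * e + 1 - i)] once [h1 (i - 1) = h1 i = s]. For [s = 2 * r] this
     fails at [i = r], since [h1 (r - 1) = 2 * r - 1]. The condition [r < i] excludes a degree only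
     when [t = 3 * r], as [t - s >= s - r >= r]. *)
  have Thi i : (t - s <= i <= e)%N -> (r < i)%N -> T i = (t - s)%N.
    move=> it ri; have -> : (t - s)%N = T e by lia.
    apply: (oseq_plateau oT (j' := (2 * e + 1 - i)%N)); try lia.
    have := sh i ltac:(lia); rewrite (hE i); last by lia.
    have -> : (2 * e + 1 - i)%N = (2 * e - i).+1 by lia.
    by rewrite hS ?sh1 ?h1hi; lia.
  (* For [s = 2 * r] the index is [r - 1], still in the range of slope two; hence the two formulas
     for [h (s - r)]. *)
  have h1s : h1 (s - r).-1 = (if s == 2 * r then 2 * r - 1 else s)%N.
    by case: eqP => ?; [rewrite h1lo; lia | rewrite h1mid; lia].
  split=> [i ir|]; first by rewrite h2lo; lia.
  split=> [i ir|]; first by rewrite h2hi; lia.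
  split=> [i ir|]; first by rewrite h1lo; lia.
  split=> [i ir|]; first by rewrite h1mid; lia.
  split=> [i ir|]; first by rewrite h1hi; lia.
  split=> t3.
    have s2 : s = (2 * r)%N by lia.
    have hhi i : (r < i <= e)%N -> h i = (3 * r)%N.
      by move=> ir; rewrite hE ?Thi ?h1hi; lia.
    have hr : h r = (T r + (2 * r - 1))%N by rewrite hE ?h1lo; lia.
    (* The bounds [r = T1 r <= T r <= r + 1] leave two values of [T r], one for each alternative at
       [h r]. *)
    have Tr1 := oT.1 r ltac:(lia).
    have Tr2 : (r <= T r)%N.
      by have := T1T r ltac:(lia); rewrite T1hi; lia.
    have [Tr|Tr] := eqVneq (T r) r; [right|left]; (split; first by apply: h00; lia);
      (split=> [i ir|]; first by apply: hlo; lia).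
      by split=> [|i ir]; [lia | apply: hhi; lia].
    move=> i ir; have [->|ni] := eqVneq i r; first by lia.
    by apply: hhi; lia.
  split; first by apply: h00; lia.
  split=> [i ir|]; first by rewrite hE ?h1lo ?Tmid; lia.
  split=> [i ir|]; first by rewrite hE ?h1mid ?Tmid; lia.
  split=> [ts sr|].
    by rewrite hE ?h1s ?Tmid; try lia; case: eqP; lia.
  split=> [ts sr|].
    by rewrite hE ?h1s ?Tmid; try lia; case: eqP; lia.
  split=> i ir; first by rewrite hE ?h1hi ?Tmid; lia.
  by rewrite hE ?Thi ?h1hi; lia.
- move=> r_e sE tE.
  (* The extremal [s] and [t] mean [T1 e = T e = e + 1], so [T1] and [T] are generic up to the
     middle degree. *)
  have h1mid i : (r < i <= e)%N -> h1 i = (i + 1 + r)%N.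
    by move=> ir; rewrite h1E ?T1mid ?h2hi; lia.
  have h1r : h1 r = (2 * r + 1)%N.
    by rewrite h1E ?T1mid ?h2lo; lia.
  have h1e : h1 e.-1 = (e + r)%N.
    have [re1|re1] := eqVneq e.-1 r; first by rewrite re1; lia.
    by rewrite h1mid; lia.
  have Te : (T e + h1 e.-1)%N = t by rewrite -hE //; lia.
  have Tmid i : (i <= e)%N -> T i = i.+1.
    by move=> ie; apply: (oseq_generic oT (j := e)); lia.
  have h1lo' i : (i <= r)%N -> h1 i = (2 * i + 1)%N.
    by have [->//|ir ?] := eqVneq i r; apply: h1lo; lia.
  split=> [//|]; split=> [i ir|]; first by apply: h1mid; lia.
  split; first by apply: h00; lia.
  by split=> i ir; [rewrite hE ?h1lo' ?Tmid; lia | rewrite hE ?h1mid ?Tmid; lia].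
- move=> rE' i ie; split; first by rewrite h2lo; lia.
  split; first by rewrite h1lo; lia.
  split; first by apply: h00; lia.
  by move=> i1; apply: hlo; lia.
Qed.

(** * Macaulay's growth bound for two commuting lowering operators *)

Section Macaulay.
Local Open Scope ring_scope.
Variables (k : fieldType) (N : nat) (Y Z : 'M[k]_N) (K : nat -> 'M[k]_N).
Hypothesis comYZ : (Y *m Z = Z *m Y)%R.
Hypothesis KY : forall i, (K i.+1 *m Y <= K i)%MS.
Hypothesis KZ : forall i, (K i.+1 *m Z <= K i)%MS.
Hypothesis K0 : (\rank (K 0%N) <= 1)%N.
Hypothesis Kinj : forall i, ((K i.+1 :&: kermx Y) :&: kermx Z)%MS = 0%R.

Lemma ker_comm (A B : 'M[k]_N) : (A *m B = B *m A)%R ->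
  (kermx A *m B <= kermx A)%MS.
Proof.
by move=> AB; apply/sub_kermxP; rewrite -mulmxA -AB mulmxA mulmx_ker mul0mx.
Qed.

Lemma cap_kerY_inj m i (W : 'M[k]_(m, N)) : (W <= K i.+1)%MS ->
  \rank ((W :&: kermx Y) *m Z)%MS = \rank (W :&: kermx Y)%MS.
Proof.
move=> WK; apply/mxrank_injP; rewrite -submx0 -(Kinj i).
by apply: capmxS => //; apply: capmxS.
Qed.

(** By [Kinj], [Z] is injective on [ker Y] in positive degree; commuting with [Y], it maps this
    kernel into [ker Y] one degree lower, and so down to degree 0. *)
Lemma rank_kerY i : (\rank (K i :&: kermx Y)%MS <= 1)%N.
Proof.
elim: i => [|i IH]; first exact: leq_trans (mxrankS (capmxSl _ _)) K0.
rewrite -(@cap_kerY_inj _ i) //; apply: leq_trans (mxrankS _) IH.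
apply: submx_trans (capmxMr _ _ _) _; apply: capmxS => //.
by apply: ker_comm.
Qed.

Lemma rank_le_binary i : (\rank (K i) <= i.+1)%N.
Proof.
elim: i => [|i IH]; first exact: K0.
rewrite -(mxrank_mul_ker _ Y); have := mxrankS (KY i); have := rank_kerY i.+1.
lia.
Qed.

(* If the rank grows, then [W Y = W'] and [W] meets [ker Y], and the pair [W', W' Y]
   inherits the same strict growth one degree lower. *)
Lemma macaulay_growth i m m' (W : 'M[k]_(m, N)) (W' : 'M[k]_(m', N)) :
  (W <= K i.+1)%MS -> (W' <= K i)%MS -> (W *m Y <= W')%MS -> (W *m Z <= W')%MS ->
  (\rank W' < \rank W)%N -> (i < \rank W')%N.
Proof.
elim: i m m' W W' => [|i IH] m m' W W' WK W'K WY WZ ltW.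
  have kerW : (0 < \rank (W :&: kermx Y)%MS)%N.
    by have := mxrank_mul_ker W Y; have := mxrankS WY; lia.
  rewrite -(cap_kerY_inj WK) in kerW; apply: leq_trans kerW _.
  by apply/mxrankS/(submx_trans _ WZ)/submxMr/capmxSl.
have kerWK : (\rank (W :&: kermx Y)%MS <= 1)%N.
  by apply: leq_trans (rank_kerY i.+2); apply/mxrankS/capmxS.
have rWY := mxrank_mul_ker W Y.
have rWYW' := mxrankS WY.
(* Passing to [W Y] lowers the rank by at most one, so [W Y] must fill [W']. *)
have W'Y : (W' <= W *m Y)%MS by rewrite -(mxrank_leqif_sup WY); lia.
have kerW' : (0 < \rank (W' :&: kermx Y)%MS)%N.
  have kerW : (0 < \rank (W :&: kermx Y)%MS)%N by lia.
  rewrite -(cap_kerY_inj WK) in kerW; apply: leq_trans kerW (mxrankS _).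
  by apply: submx_trans (capmxMr _ _ _) _; apply: capmxS => //; apply: ker_comm.
have rW'Y := mxrank_mul_ker W' Y.
have := IH _ _ W' (W' *m Y)%R W'K _ (submx_refl _) _ _.
suff: (W' *m Y <= K i)%MS /\ (W' *m Z <= W' *m Y)%MS by lia.
split; first exact: submx_trans (submxMr _ W'K) (KY i).
(* Here [W' Z <= W Y Z = W Z Y <= W' Y]. *)
apply: submx_trans (submxMr _ W'Y) _.
by rewrite -mulmxA comYZ mulmxA; apply: submxMr.
Qed.

Lemma macaulay_oseq D (W : nat -> 'M[k]_N) :
  (forall i, i <= D -> (W i <= K i)%MS)%N ->
  (forall i, i < D -> (W i.+1 *m Y <= W i)%MS)%N ->
  (forall i, i < D -> (W i.+1 *m Z <= W i)%MS)%N ->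
  planar_oseq D (fun i => \rank (W i)).
Proof.
move=> WK WY WZ; split=> i iD.
  by apply: leq_trans (rank_le_binary i); apply/mxrankS/WK.
move=> rW; rewrite leqNgt; apply: contraL rW => rW; rewrite -ltnNge.
by apply: macaulay_growth (WK _ iD) (WK _ (ltnW iD)) (WY _ iD) (WZ _ iD) rW.
Qed.

End Macaulay.

(** * Hankel matrices, contraction and inverse systems *)

Section Hankel.
Local Open Scope ring_scope.
Variables (k : fieldType) (b : nat).

Local Notation N := #|{: 'X_{1..3 < b}}|.
Implicit Types (v : 'rV[k]_N) (m : 'X_{1..3}) (f phi : 'X_{1..3} -> k).

Definition mon (a : 'I_N) : 'X_{1..3} := bmnm (enum_val a).

Lemma mdeg_mon a : (mdeg (mon a) < b)%N.
Proof. exact: bmdeg. Qed.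

Lemma mon_inj : injective mon.
Proof. by move=> a c ac; apply/enum_val_inj/val_inj. Qed.

Lemma monP m : (mdeg m < b)%N -> exists a, mon a = m.
Proof. by move=> mb; exists (enum_rank (BMultinom mb)); rewrite /mon enum_rankK. Qed.

Definition vec f : 'rV[k]_N := \row_a f (mon a).

(* Coordinate of [v] at the monomial [m], with value 0 when [mdeg m >= b]. *)
Definition ev v m : k := \sum_(a | mon a == m) v 0 a.

Lemma ev_mon v a : ev v (mon a) = v 0 a.
Proof.
rewrite /ev (bigD1 a) //= big1 ?addr0 // => c /andP[/eqP /mon_inj ->].
by rewrite eqxx.
Qed.

Lemma ev_out v m : (b <= mdeg m)%N -> ev v m = 0.
Proof.
move=> bm; rewrite /ev big1 // => a /eqP am.
by have := mdeg_mon a; rewrite am ltnNge bm.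
Qed.

Lemma ev_inj v w : (forall m, ev v m = ev w m) -> v = w.
Proof. by move=> vw; apply/rowP => a; rewrite -!ev_mon. Qed.

Lemma ev_vec f m : ev (vec f) m = if (mdeg m < b)%N then f m else 0.
Proof.
case: ltnP => [/monP[a <-]|/ev_out //]; by rewrite ev_mon mxE.
Qed.

(** Contraction by a variable, acting on rows from the right: the dual of multiplication by that
    variable, truncated at degree [b]. *)
Definition shift (p : 'I_3) : 'M[k]_N :=
  \matrix_(a, c) (mon a == mon c + U_(p))%MM%:R.

Lemma ev_shift v p m : ev (v *m shift p) m = ev v (m + U_(p))%MM.
Proof.
case: (ltnP (mdeg m) b) => [/monP[c <-]|bm]; last first.
  by rewrite !ev_out // mdegD mdeg1 addn1 leqW.
rewrite ev_mon mxE /ev [RHS]big_mkcond /=; apply: eq_bigr => a _.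
by rewrite mxE; case: eqP => _; rewrite ?mulr1 ?mulr0.
Qed.

Lemma shiftC p q : shift p *m shift q = shift q *m shift p.
Proof.
apply/row_matrixP => i; rewrite !rowE !mulmxA; apply: ev_inj => m.
by rewrite !ev_shift -!addmA [(U_(q) + _)%MM]addmC.
Qed.

Variable c : 'I_3 -> k.

Definition lshift : 'M[k]_N := \sum_p c p *: shift p.

Definition contr phi m : k := \sum_p c p * phi (m + U_(p))%MM.

Lemma mul_lshift v : v *m lshift = \sum_p c p *: (v *m shift p).
Proof. by rewrite mulmx_sumr; apply: eq_bigr => p _; rewrite scalemxAr. Qed.

Lemma lshiftC p : lshift *m shift p = shift p *m lshift.
Proof.
rewrite mulmx_suml mulmx_sumr; apply: eq_bigr => q _.
by rewrite -scalemxAl -scalemxAr shiftC.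
Qed.

Definition deg_part (i : nat) : 'M[k]_N := diag_mx (\row_a (mdeg (mon a) == i)%:R).

Lemma sub_deg_partP v i :
  reflect (forall m, mdeg m != i -> ev v m = 0) (v <= deg_part i)%MS.
Proof.
apply: (iffP submxP) => [[u ->] m mi|vi].
  case: (ltnP (mdeg m) b) => [/monP[a am]|/ev_out //].
  by rewrite -am ev_mon mul_mx_diag !mxE am (negbTE mi) mulr0.
exists v; apply/rowP => a; rewrite mul_mx_diag !mxE.
by have := vi (mon a); rewrite ev_mon; case: eqP => [_ _|_ /(_ isT) ->];
  rewrite ?mulr1 ?mul0r.
Qed.

Lemma rank_deg_part0 : (\rank (deg_part 0) <= 1)%N.
Proof.
apply: leq_trans (mxrankS _) (rank_leq_row (vec (fun m => (mdeg m == 0%N)%:R))).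
apply/row_subP => a; case: (eqVneq (mdeg (mon a)) 0%N) => [a0|a0].
  rewrite (_ : row a _ = vec (fun m => (mdeg m == 0%N)%:R)) //.
  apply/rowP => c'; rewrite !mxE; case: (eqVneq a c') => [<-|ac].
    by rewrite mulr1n.
  rewrite mulr0n; case: eqP => // c0; case/eqP: ac; apply: mon_inj.
  by apply/eqP; move/eqP: a0; move/eqP: c0; rewrite !mdeg_eq0 => /eqP-> /eqP->.
rewrite (_ : row a _ = 0) ?sub0mx //; apply/rowP => c'; rewrite !mxE.
by rewrite (negbTE a0) mul0rn.
Qed.

Lemma deg_part_shift i p : (deg_part i.+1 *m shift p <= deg_part i)%MS.
Proof.
apply/row_subP => a; rewrite row_mul; apply/sub_deg_partP => m mi.
rewrite ev_shift; have /sub_deg_partP := row_sub a (deg_part i.+1); apply.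
by rewrite mdegD mdeg1 addn1 eqSS.
Qed.

(** For [i < b] this is the dual of the degree [i] part of [S / (l)], where [l] has coefficients
    [c]; it serves as [K i] in the Macaulay bound. *)
Definition lker (i : nat) : 'M[k]_N := (deg_part i :&: kermx lshift)%MS.

Lemma lker_shift i p : (lker i.+1 *m shift p <= lker i)%MS.
Proof.
apply: submx_trans (capmxMr _ _ _) (capmxS (deg_part_shift _ _) _).
exact/ker_comm/lshiftC.
Qed.

(** A vector killed by [l] and two variables is killed by the third, whose coefficient in [l] is
    nonzero. Every monomial of positive degree is a multiple of a variable, so the vector
    vanishes. *)
Lemma lker_inj p q r i : c p != 0 -> (forall a, [|| a == p, a == q | a == r]) ->
  (lker i.+1 :&: kermx (shift q) :&: kermx (shift r))%MS = 0.
Proof.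
move=> cp pqr; apply/eqP; rewrite -submx0; apply/rV_subP => v.
rewrite !sub_capmx => /andP[/andP[/andP[/sub_deg_partP vi /sub_kermxP vl]]].
move=> /sub_kermxP vq /sub_kermxP vr.
have vp : v *m shift p = 0.
  apply/eqP; have := vl; rewrite mul_lshift (bigD1 p) //= big1 ?addr0.
    by move/eqP; rewrite scaler_eq0 (negbTE cp).
  by move=> a ap; have := pqr a; rewrite (negbTE ap) /= => /orP[] /eqP->;
    rewrite ?vq ?vr scaler0.
have v0 a : v *m shift a = 0 by have /or3P[] := pqr a => /eqP ->.
rewrite submx0; apply/eqP/ev_inj => m.
rewrite [RHS](_ : _ = 0); last by rewrite /ev big1 // => a _; rewrite mxE.
have [mi|/vi //] := eqVneq (mdeg m) i.+1.
have [m0|[a ma]] : m = 0%MM \/ exists a, m a != 0%N.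
  have [->|m0] := eqVneq m 0%MM; [by left | right].
  apply/existsP; apply: contraNT m0; rewrite negb_exists => /forallP m0.
  by apply/eqP/mnmP => a; rewrite mnm0E; apply/eqP; rewrite -[_ == _]negbK.
  by rewrite m0 mdeg0 in mi.
rewrite -(@submK _ U_(a)%MM m) ?lep1mP // -ev_shift v0.
by rewrite /ev big1 // => ? _; rewrite mxE.
Qed.

Definition hrow phi m := vec (fun m' => phi (m + m')%MM).

(** Zero rows outside degree [j] keep the matrices of all degrees in one square size, on which the
    [shift] matrices act. *)
Definition hankel (j : nat) phi : 'M[k]_N :=
  \matrix_(a, a') if mdeg (mon a) == j then phi (mon a + mon a')%MM else 0.

Definition supported (D : nat) phi := forall m, mdeg m != D -> phi m = 0.

Lemma row_hankel j phi a :
  row a (hankel j phi) = if mdeg (mon a) == j then hrow phi (mon a) else 0.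
Proof. by apply/rowP => a'; rewrite !mxE; case: ifP; rewrite !mxE. Qed.

Lemma hankel_subP j phi (V : 'M[k]_N) :
  (forall m, mdeg m = j -> (hrow phi m <= V)%MS) -> (hankel j phi <= V)%MS.
Proof.
move=> jV; apply/row_subP => a; rewrite row_hankel.
by case: eqP => [/jV //|_]; apply: sub0mx.
Qed.

Lemma hrow_sub_hankel phi m :
  (mdeg m < b)%N -> (hrow phi m <= hankel (mdeg m) phi)%MS.
Proof.
case/monP=> a <-; have := row_sub a (hankel (mdeg (mon a)) phi).
by rewrite row_hankel eqxx.
Qed.

Lemma eq_hankel j phi psi : phi =1 psi -> hankel j phi = hankel j psi.
Proof. by move=> e; apply/matrixP => a a'; rewrite !mxE e. Qed.

(** Only pairs of monomials of total degree [D] contribute, so transposition exchanges degrees [j]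
    and [D - j]: this is Gorenstein duality. *)
Lemma rank_hankel_sym D j phi : supported D phi -> (j <= D)%N ->
  \rank (hankel (D - j) phi) = \rank (hankel j phi).
Proof.
move=> sphi jD; rewrite -mxrank_tr; congr (\rank _).
apply/matrixP => a a'; rewrite !mxE addmC.
have [aa'|aa'] := eqVneq (mdeg (mon a + mon a')%MM) D; last first.
  by rewrite (sphi _ aa'); case: ifP; case: ifP.
rewrite (_ : (mdeg (mon a') == D - j)%N = (mdeg (mon a) == j)) //.
by move: aa'; rewrite mdegD => aa'; apply/eqP/eqP; lia.
Qed.

(** Exponents in degree [j] are at most [j], which bounds the number of nonzero rows. Thus the
    cutoff in [hilb] does not truncate the rank. *)
Lemma rank_hankel_le_card j phi : (\rank (hankel j phi) <= j.+1 ^ 3)%N.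
Proof.
pose T := {ffun 'I_3 -> 'I_j.+1}.
have cT : #|T| = (j.+1 ^ 3)%N by rewrite card_ffun !card_ord.
pose M : 'M[k]_(#|T|, N) :=
  \matrix_(t < #|T|) hrow phi [multinom nat_of_ord ((enum_val t : T) i) | i < 3].
rewrite -cT; apply: leq_trans (mxrankS _) (rank_leq_row M).
apply/row_subP => a; rewrite row_hankel; case: eqP => [aj|_]; last exact: sub0mx.
have lt_aj i : (mon a i < j.+1)%N.
  by rewrite ltnS -aj mdegE (bigD1 i) //= leq_addr.
have := row_sub (enum_rank ([ffun i => Ordinal (lt_aj i)] : T)) M.
rewrite rowK enum_rankK (_ : [multinom _ | i < 3] = mon a) //.
by apply/mnmP => i; rewrite mnmE ffunE.
Qed.

Section Supported.
Variables (D : nat) (phi : 'X_{1..3} -> k).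
Hypothesis sphi : supported D phi.

Lemma supported_contr : supported D.-1 (contr phi).
Proof.
move=> m mD; rewrite /contr big1 // => p _.
by rewrite sphi ?mulr0 // mdegD mdeg1; apply: contraNneq mD => <-; rewrite addn1.
Qed.

Hypothesis Db : (D < b)%N.

(** Since [D < b], the values lost by truncation at degree [b] are all zero. *)
Lemma ev_hrow m m' : ev (hrow phi m) m' = phi (m + m')%MM.
Proof.
rewrite ev_vec; case: ltnP => // bm; rewrite sphi // mdegD neq_ltn.
by rewrite (leq_trans Db) ?orbT // (leq_trans bm) ?leq_addl.
Qed.

Lemma hrow_shift p m : hrow phi m *m shift p = hrow phi (m + U_(p))%MM.
Proof.
by apply: ev_inj => m'; rewrite ev_shift !ev_hrow -!addmA [(m' + _)%MM]addmC.
Qed.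

Lemma hrow_contr m :
  hrow (contr phi) m = \sum_p c p *: hrow phi (m + U_(p))%MM.
Proof.
apply/rowP => a; rewrite summxE mxE; apply: eq_bigr => p _.
by rewrite !mxE -!addmA [(mon a + _)%MM]addmC.
Qed.

Lemma hankel_lshift j : hankel j phi *m lshift = hankel j (contr phi).
Proof.
apply/row_matrixP => a; rewrite row_mul !row_hankel; case: ifP => _.
  rewrite mul_lshift hrow_contr; apply: eq_bigr => p _.
  by rewrite hrow_shift.
by rewrite mul0mx.
Qed.

(** For [i <= D] and [phi] supported in degree [D], rows at monomials of degree [D - i] live in
    degree [i], so [i] is the degree in the inverse system. *)
Definition hker (i : nat) : 'M[k]_N := (hankel (D - i) phi :&: kermx lshift)%MS.

Lemma rank_hankel_split i : \rank (hankel (D - i) phi) =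
  (\rank (hker i) + \rank (hankel (D - i) (contr phi)))%N.
Proof. by rewrite -hankel_lshift addnC mxrank_mul_ker. Qed.

Lemma hker_sub_lker i : (i <= D)%N -> (hker i <= lker i)%MS.
Proof.
move=> iD; apply: capmxS => //; apply: hankel_subP => m mD.
apply/sub_deg_partP => m' m'i; rewrite ev_hrow sphi // mdegD mD.
by apply: contraNneq m'i => ?; apply/eqP; lia.
Qed.

Lemma hker_shift i p : (i < D)%N -> (hker i.+1 *m shift p <= hker i)%MS.
Proof.
move=> iD; apply: submx_trans (capmxMr _ _ _) (capmxS _ _).
  apply/row_subP => a; rewrite row_mul row_hankel; case: eqP => [aD|_]; last first.
    by rewrite mul0mx sub0mx.
  rewrite hrow_shift (_ : D - i = mdeg (mon a + U_(p))%MM)%N.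
    by apply: hrow_sub_hankel; rewrite mdegD mdeg1; lia.
  by rewrite mdegD mdeg1; lia.
exact/ker_comm/lshiftC.
Qed.

Lemma hker_oseq p : c p != 0 -> planar_oseq D (fun i => \rank (hker i)).
Proof.
have [q [r pqr]] : exists q r, forall a : 'I_3, [|| a == p, a == q | a == r].
  (* The cyclic successor and predecessor of [p] are the two other indices; their contractions serve
     as [Y] and [Z]. *)
  exists (ordS p), (ord_pred p) => a; rewrite -!val_eqE /=; case: p a => [[|[|[|?]]] ?] [[|[|[|?]]] ?] //.
move=> cp; apply: (macaulay_oseq (shiftC q r) (lker_shift ^~ q) (lker_shift ^~ r)).
- by apply: leq_trans (mxrankS (capmxSl _ _)) rank_deg_part0.
- by move=> i; apply: lker_inj cp pqr.
- exact: hker_sub_lker.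
- by move=> i; apply: hker_shift.
- by move=> i; apply: hker_shift.
Qed.

End Supported.

(** Each derivative of [l o phi] is a combination of derivatives of [phi] of order one higher. This
    orders the functions [T]. *)
Lemma hker_contr_sub D phi i : supported D phi -> (0 < D < b)%N -> (i < D)%N ->
  (hker D.-1 (contr phi) i <= hker D phi i)%MS.
Proof.
move=> sphi Db iD; apply: capmxS => //; apply: hankel_subP => m mD.
rewrite hrow_contr; apply: summx_sub => p _; apply: scalemx_sub.
rewrite (_ : D - i = mdeg (m + U_(p))%MM)%N; last by rewrite mdegD mdeg1; lia.
by apply: hrow_sub_hankel; rewrite mdegD mdeg1; lia.
Qed.

End Hankel.

(** * The differentiation action on moments, and [hilb] as a Hankel rank *)

Section Moments.
Local Open Scope ring_scope.
Variable k : fieldType.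
Implicit Types (g h G : {mpoly k[3]}) (m : 'X_{1..3}).

(** A summation range independent of [g] is what makes linearity in [g] visible. *)
Lemma actwE n g G : (msize g <= n)%N ->
  act g G = \sum_(m : 'X_{1..3 < n}) g@_m *: G^`M[m].
Proof.
move=> gn; pose I : subFinType _ := 'X_{1..3 < n}.
rewrite /act (big_mksub I) ?msupp_uniq //=; last first.
  by move=> m /msize_mdeg_lt /leq_trans; apply.
by rewrite big_rmcond //= => m /memN_msupp_eq0 ->; rewrite scale0r.
Qed.

Lemma act_is_linear G : linear (fun g => act g G).
Proof.
move=> a g h; pose n := maxn (msize (a *: g + h)) (maxn (msize g) (msize h)).
rewrite !(@actwE n) ?leq_max ?leqnn ?orbT // scaler_sumr -big_split /=.
by apply: eq_bigr => m _; rewrite mcoeffD mcoeffZ scalerDl scalerA.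
Qed.

Definition actr G g := act g G.

HB.instance Definition _ G :=
  GRing.isLinear.Build k {mpoly k[3]} {mpoly k[3]} _ (actr G) (act_is_linear G).

Lemma act_sum (I : Type) (s : seq I) (P : pred I) (a : I -> k) (g : I -> {mpoly k[3]}) G :
  act (\sum_(i <- s | P i) a i *: g i) G = \sum_(i <- s | P i) a i *: act (g i) G.
Proof.
rewrite -[LHS]/(actr G _) linear_sum; apply: eq_bigr => i _; exact: linearZ.
Qed.

Lemma act_mpolyX m G : act 'X_[m] G = G^`M[m].
Proof. by rewrite /act msuppX big_seq1 mcoeffX eqxx scale1r. Qed.

Lemma act_mul g h G : act (g * h) G = act g (act h G).
Proof.
rewrite {1}[g]mpolyE mulr_suml.
under eq_bigr do rewrite -scalerAl.
rewrite act_sum; apply: eq_bigr => m _; congr (_ *: _).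
rewrite {1}[h]mpolyE mulr_sumr.
under eq_bigr do rewrite -scalerAr -mpolyXD.
rewrite act_sum {2}/act linear_sum; apply: eq_bigr => m' _.
by rewrite linearZ /= act_mpolyX addmC mderivmDm.
Qed.

(** The coefficient at [m] times the factorials of its exponents; this scaling turns differentiation
    into a plain index shift. *)
Definition moment G m : k := (G^`M[m])@_0%MM.

Lemma moment_sum (I : Type) (s : seq I) (P : pred I) (a : I -> k) (F : I -> {mpoly k[3]}) m :
  moment (\sum_(i <- s | P i) a i *: F i) m = \sum_(i <- s | P i) a i * moment (F i) m.
Proof.
rewrite /moment linear_sum raddf_sum; apply: eq_bigr => i _.
by rewrite linearZ /= mcoeffZ.
Qed.

Lemma moment_mderivm G m m' : moment (G^`M[m]) m' = moment G (m + m')%MM.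
Proof. by rewrite /moment mderivmDm. Qed.

Lemma moment_supported D G : G \is D.-homog -> supported D (moment G).
Proof.
move=> hG m mD; rewrite /moment mcoeff_mderivm addm0.
by rewrite (dhomog_nemf_coeff hG mD) mul0rn.
Qed.

Lemma moment_eq0 G : [pchar k] =i pred0 -> (forall m, moment G m = 0) -> G = 0.
Proof.
move=> /pcharf0P k0 G0; apply/mpolyP => m; rewrite mcoeff0.
have := G0 m; rewrite /moment mcoeff_mderivm addm0 -mulr_natr.
move/eqP; rewrite mulf_eq0 k0 => /orP[/eqP //|].
by rewrite eqn0Ngt prodn_gt0 // => i; rewrite ffactnn fact_gt0.
Qed.

Lemma linear_formE l : l \is 1.-homog -> l = \sum_p l@_U_(p) *: 'X_p :> {mpoly k[3]}.
Proof.
move=> hl; apply/mpolyP => m; rewrite raddf_sum /=.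
under eq_bigr do rewrite mcoeffZ mcoeffX.
have [/eqP/mdeg1P[p /eqP ->]|m1] := eqVneq (mdeg m) 1%N.
  rewrite (bigD1 p) //= big1 ?addr0 ?eqxx ?mulr1 // => q qp.
  by rewrite eq_mnm1 (negbTE qp) mulr0.
rewrite (dhomog_nemf_coeff hl m1) big1 // => p _.
have [mp|_] := eqVneq U_(p)%MM m; last by rewrite mulr0.
by rewrite -mp mdeg1 in m1.
Qed.

Lemma moment_act_linear l G : l \is 1.-homog ->
  moment (act l G) =1 contr (fun p => l@_U_(p)) (moment G).
Proof.
move=> hl m; rewrite {1}(linear_formE hl) act_sum moment_sum.
by apply: eq_bigr => p _; rewrite act_mpolyX moment_mderivm addmC.
Qed.

Section Hilb.
Variables (b D j : nat) (G : {mpoly k[3]}).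
Hypotheses (chk : [pchar k] =i pred0) (sG : supported D (moment G)).
Hypotheses (Db : (D < b)%N) (jb : (j < b)%N).
Local Notation N := #|{: 'X_{1..3 < b}}|.
Local Notation H := (hankel b j (moment G)).

Definition form_of (u : 'rV[k]_N) : {mpoly k[3]} :=
  \sum_(a | mdeg (mon a) == j) u 0 a *: 'X_[mon a].

Definition coef_row g : 'rV[k]_N := \row_a g@_(mon a).

Lemma form_of_homog u : form_of u \is j.-homog.
Proof.
by apply: rpred_sum => a aj; apply: rpredZ; rewrite dhomogX.
Qed.

Lemma coef_rowK g : g \is j.-homog -> form_of (coef_row g) = g.
Proof.
move=> hg; have gb : (msize g <= b)%N.
  rewrite mmeasureE; apply/bigmax_leqP_seq => m mg _.
  by rewrite (dhomog_mf hg mg).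
rewrite {2}(mpolywE gb) (reindex (@enum_val _ {: 'X_{1..3 < b}})) /=; last first.
  exact/onW_bij/enum_val_bij.
rewrite /form_of big_mkcond /=; apply: eq_bigr => a _; rewrite mxE.
by case: eqP => // /eqP aj; rewrite (dhomog_nemf_coeff hg aj) scale0r.
Qed.

Lemma form_of_hankel u : u *m H = vec b (moment (act (form_of u) G)).
Proof.
apply/rowP => c; rewrite !mxE act_sum moment_sum [RHS]big_mkcond /=.
apply: eq_bigr => a _; rewrite mxE act_mpolyX moment_mderivm.
by case: ifP => _; rewrite ?mulr0.
Qed.

Lemma mem_Ann_form u : (form_of u \in Ann G) = (u *m H == 0).
Proof.
rewrite form_of_hankel; apply/eqP/eqP => [-> | v0].
  by apply/rowP => a; rewrite !mxE /moment !raddf0.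
(* Moments of degree below [b] are entries of the zero row; the others vanish because [D < b]. *)
apply: (moment_eq0 chk) => m; case: (ltnP (mdeg m) b) => [/monP[a <-]|bm].
  by have /rowP/(_ a) := v0; rewrite !mxE.
rewrite /form_of act_sum moment_sum big1 // => a _.
rewrite act_mpolyX moment_mderivm sG ?mulr0 // mdegD; lia.
Qed.

Lemma indep_le_rank n : indep_mod_ann G j n -> (n <= \rank H)%N.
Proof.
case=> g [gh gi]; pose A : 'M[k]_(n, N) := \matrix_i coef_row (g i).
have: row_free (A *m H).
  apply: inj_row_free => v; rewrite mulmxA => vAH; apply/rowP => i; rewrite mxE.
  apply: (gi (fun i => v 0 i)).
  rewrite -[\sum_(i < n) _]coef_rowK ?mem_Ann_form; last first.
    by apply: rpred_sum => i' _; apply/rpredZ/gh.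
  rewrite (_ : coef_row _ = v *m A) ?vAH //; apply/rowP => a; rewrite !mxE.
  by rewrite raddf_sum /=; apply: eq_bigr => i' _; rewrite mcoeffZ !mxE.
by rewrite /row_free => /eqP {1}<-; apply: mxrankM_maxr.
Qed.

(** Writing a row basis of the Hankel matrix as [B *m H], the degree [j] forms read off the rows of
    [B] are independent modulo the annihilator. *)
Lemma indep_rank : indep_mod_ann G j (\rank H).
Proof.
have /submxP[B BH] : (row_base H <= H)%MS by rewrite eq_row_base.
exists (fun i => form_of (row i B)); split=> [i|c]; first exact: form_of_homog.
have -> : \sum_i c i *: form_of (row i B) = form_of ((\row_i c i) *m B).
  rewrite /form_of; under eq_bigr do rewrite scaler_sumr.
  rewrite exchange_big; apply: eq_bigr => a _ /=; rewrite mxE scaler_suml.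
  by apply: eq_bigr => i _; rewrite !mxE scalerA.
rewrite mem_Ann_form -mulmxA -BH => /eqP c0 i.
have /rowP/(_ i) : \row_i c i = 0.
  by apply: (row_free_inj (row_base_free H)); rewrite mul0mx.
by rewrite !mxE.
Qed.

Lemma asboolE (P : Prop) : asbool P <-> P.
Proof. by rewrite /asbool; case: excluded_middle_informative. Qed.

Lemma hilb_rank : hilb G j = \rank H.
Proof.
apply/eqP; rewrite eqn_leq; apply/andP; split.
  by apply/bigmax_leqP => n /asboolE; apply: indep_le_rank.
have Hj : (\rank H < (j.+1 ^ 3).+1)%N by rewrite ltnS rank_hankel_le_card.
by apply: (@bigmax_sup _ (Ordinal Hj)) => //; apply/asboolE/indep_rank.
Qed.

End Hilb.

End Moments.

(** * Hilbert functions under multiplication by [l] *)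

Section Corank.
Local Open Scope ring_scope.
Variables (k : fieldType) (b D : nat) (l G : {mpoly k[3]}).

(* Dimension of the kernel of [l] on the degree [i] part of the inverse system
   of [G]; dually, the dimension of [(S / (Ann G + (l)))_i]. *)
Definition corank i := \rank (hker b (fun p => l@_U_(p)) D (moment G) i).

Lemma corank_oseq : l \is 1.-homog -> l != 0 ->
  supported D (moment G) -> (D < b)%N -> planar_oseq D corank.
Proof.
move=> hl l0 sG Db; have /existsP[p lp] : [exists p, l@_U_(p) != 0].
  apply: contraNT l0; rewrite negb_exists => /forallP l1.
  rewrite (linear_formE hl) big1 // => p _.
  by rewrite (eqP (negbNE (l1 p))) scale0r.
exact: hker_oseq lp.
Qed.

Lemma supported_act : l \is 1.-homog -> supported D (moment G) ->
  supported D.-1 (moment (act l G)).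
Proof. by move=> hl sG m mD; rewrite moment_act_linear // (supported_contr _ sG). Qed.

Lemma corank_act_le i : l \is 1.-homog -> supported D (moment G) ->
  (0 < D < b)%N -> (i < D)%N ->
  (\rank (hker b (fun p => l@_U_(p)) D.-1 (moment (act l G)) i) <= corank i)%N.
Proof.
move=> hl sG Db iD; rewrite /hker (eq_hankel _ _ (moment_act_linear G hl)).
exact: mxrankS (hker_contr_sub _ sG Db iD).
Qed.

Hypothesis chk : [pchar k] =i pred0.
Hypotheses (sG : supported D (moment G)) (Db : (D < b)%N).

Lemma hilb_sym i : (i <= D)%N -> hilb G (D - i) = hilb G i.
Proof.
move=> iD; rewrite !(hilb_rank chk sG Db) ?(rank_hankel_sym _ sG) //.
  exact: leq_ltn_trans Db.
exact: leq_ltn_trans (leq_subr _ _) Db.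
Qed.

Lemma hilb0_corank : (0 < D)%N -> hilb G 0 = corank 0.
Proof.
move=> D0; rewrite -hilb_sym // subn0 (hilb_rank chk sG Db) //.
rewrite -[X in hankel _ X]subn0 (rank_hankel_split (fun p => l@_U_(p)) sG Db).
(* The contracted moments live in degree [D - 1], which differs from [D] as [0 < D], so their Hankel
   matrix of degree [D] is zero. *)
rewrite [X in (_ + X)%N](_ : _ = 0%N) ?addn0 //.
apply/eqP; rewrite mxrank_eq0 -submx0; apply: hankel_subP => m mD.
rewrite submx0; apply/eqP/rowP => a; rewrite !mxE (supported_contr _ sG) //.
by rewrite mdegD mD subn0 neq_ltn orbC ltn_addr ?prednK.
Qed.

(** Duality for [G] leads to rows of degree [D - (i + 1)], rank-nullity splits off the kernel of
    [l], and duality for [l o G], of degree [D - 1], leads back to degree [i]. *)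
Lemma hilbS_corank i : l \is 1.-homog -> (i < D)%N ->
  hilb G i.+1 = (corank i.+1 + hilb (act l G) i)%N.
Proof.
move=> hl iD; rewrite -hilb_sym // (hilb_rank chk sG Db); last first.
  exact: leq_ltn_trans (leq_subr _ _) Db.
rewrite (rank_hankel_split (fun p => l@_U_(p)) sG Db); congr (_ + _)%N.
have sG1 := supported_act hl sG.
have Db1 : (D.-1 < b)%N := leq_ltn_trans (leq_pred _) Db.
rewrite (hilb_rank chk sG1 Db1); last exact: ltn_trans Db.
rewrite -(rank_hankel_sym _ sG1); last by case: D iD.
rewrite subnS -subn1 subnAC subn1.
by rewrite (eq_hankel _ _ (moment_act_linear G hl)).
Qed.

End Corank.

(** Every polynomial annihilates 0, so only the empty family is independent. *)
Lemma hilb_eq0 (k : fieldType) j : hilb (0%R : {mpoly k[3]}) j = 0%N.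
Proof.
apply/eqP; rewrite -leqn0; apply/bigmax_leqP => -[[|n] //= Hn] /asboolE[g [_ gi]].
have /(_ (fun=> 1%R)) := gi; have := oner_neq0 k.
move=> /eqP n1 /(_ _ ord0) g1; case: n1; apply: g1.
by apply/eqP; rewrite /act big1 // => m _; rewrite raddf0 scaler0.
Qed.

(** * Application to [F], [l o F] and [l^2 o F] *)

Theorem theorem4p4 (k : fieldType) (Hchar : [pchar k]%R =i pred0)
  (d : nat) (F l : {mpoly k[3]})
  (HF0 : F != 0%R) (HFh : F \is d.-homog) (Hodd : odd d) (Hd3 : (3 <= d)%N)
  (Hl1 : l \is 1.-homog)
  (Hl2 : act (l ^+ 2)%R F != 0%R) (Hl3 : act (l ^+ 3)%R F = 0%R) :
  let e := ((d - 1) %/ 2)%N in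
  let hA := hilb F in
  let hA1 := hilb (act l F) in
  let hA2 := hilb (act (l ^+ 2)%R F) in
  let r := hA2 e in
  let s := hA1 e in
  let t := hA e in
  (* (1) *)
  ((5 <= d)%N -> (1 <= r <= e - 1)%N -> (2 * r <= s <= e + r)%N ->
   (2 * s - r <= t <= e + s + 1)%N ->
     (forall i, (i <= r - 1)%N -> hA2 i = i + 1)%N
  /\ (forall i, (r <= i <= e)%N -> hA2 i = r)
  /\ (forall i, (i <= r - 1)%N -> hA1 i = 2 * i + 1)%N
  /\ (forall i, (r <= i <= s - r - 1)%N -> hA1 i = i + r + 1)%N
  /\ (forall i, (s - r <= i <= e)%N -> hA1 i = s)
  /\ (t = 3 * r ->
        (hA 0 = 1
         /\ (forall i, (1 <= i <= r - 1)%N -> hA i = 3 * i)%N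
         /\ (forall i, (r <= i <= e)%N -> hA i = 3 * r)%N)
     \/ (hA 0 = 1
         /\ (forall i, (1 <= i <= r - 1)%N -> hA i = 3 * i)%N
         /\ hA r = (3 * r - 1)%N
         /\ (forall i, (r + 1 <= i <= e)%N -> hA i = 3 * r)%N))%N
  /\ (t <> 3 * r ->
        hA 0 = 1
     /\ (forall i, (1 <= i <= r)%N -> hA i = 3 * i)%N
     /\ (forall i, (r + 1 <= i <= s - r - 1)%N -> hA i = 2 * i + r + 1)%N
     /\ ((2 * s - r < t)%N -> (2 * r < s)%N ->
           hA (s - r)%N = (2 * (s - r) + r + 1)%N)
     /\ ((2 * s - r < t)%N -> s = (2 * r)%N ->
           hA (s - r)%N = (2 * (s - r) + r)%N)
     /\ (forall i, (s - r + 1 <= i <= t - s - 1)%N -> hA i = i + s + 1)%N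
     /\ (forall i, (t - s <= i <= e)%N -> hA i = t))%N)
  (* (2) *)
  /\ ((1 <= r <= e - 1)%N -> s = (e + r + 1)%N -> t = (d + r)%N ->
        (forall i, (i <= r)%N -> hA1 i = 2 * i + 1)%N
     /\ (forall i, (r + 1 <= i <= e)%N -> hA1 i = i + 1 + r)%N
     /\ hA 0 = 1
     /\ (forall i, (1 <= i <= r + 1)%N -> hA i = 3 * i)%N
     /\ (forall i, (r + 2 <= i <= e)%N -> hA i = 2 * i + 1 + r)%N)
  (* (3) *)
  /\ (r = e -> (d - 1 <= s <= d)%N -> (e + s - 1 <= t <= 3 * e)%N ->
        forall i, (i <= e - 1)%N ->
          hA2 i = (i + 1)%N /\ hA1 i = (2 * i + 1)%N
          /\ hA 0 = 1 /\ ((1 <= i)%N -> hA i = (3 * i)%N)).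

Proof.
set e := ((d - 1) %/ 2)%N.
have dE : d = (2 * e + 1)%N by rewrite /e; lia.
have e0 : (0 < e)%N by lia.
have l0 : l != 0%R.
  by apply: contraNneq Hl2 => ->; rewrite expr0n /act msupp0 big_nil.
have l2E : act (l ^+ 2)%R F = act l (act l F) by rewrite expr2 act_mul.
have l3E : act l (act l (act l F)) = 0%R by rewrite -!act_mul -expr2 -exprSr.
rewrite l2E; set F1 := act l F; set F2 := act l F1.
have sF : supported d (moment F) := moment_supported HFh.
have sF1 : supported d.-1 (moment F1) := supported_act Hl1 sF.
have sF2 : supported d.-2 (moment F2) := supported_act Hl1 sF1.
have d1 : (d.-1 < d.+1)%N by lia.
have d2 : (d.-2 < d.+1)%N by lia.
(* The single truncation bound [d + 1] serves all three forms, of degrees [2 * e + 1], [2 * e] and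
   [2 * e - 1]. *)
have := @hilbert_functions_of_cube_zero e (hilb F) (hilb F1) (hilb F2)
  (corank d.+1 d l F) (corank d.+1 d.-1 l F1) (corank d.+1 d.-2 l F2) e0.
have dE1 : (2 * e = d.-1)%N by lia.
have dE2 : (2 * e - 1 = d.-2)%N by lia.
rewrite -dE dE2 dE1; case.
- exact: corank_oseq.
- exact: corank_oseq.
- exact: corank_oseq.
- by move=> i id; apply: corank_act_le => //; lia.
- by move=> i id; apply: corank_act_le => //; lia.
- by move=> i id; apply: (hilb_sym Hchar sF (ltnSn d)).
- by move=> i id; apply: (hilb_sym Hchar sF1 d1).
- by move=> i id; apply: (hilb_sym Hchar sF2 d2).
- by apply: (hilb0_corank _ Hchar sF (ltnSn d)); lia.
- by move=> i id; apply: (hilbS_corank Hchar sF (ltnSn d) Hl1); lia.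
- by apply: (hilb0_corank _ Hchar sF1 d1); lia.
- by move=> i id; apply: (hilbS_corank Hchar sF1 d1 Hl1); lia.
(* Since [l o F2 = 0], the second summand of [hilbS_corank] vanishes; degree 0 is separate. *)
- case=> [_|i id]; first by apply: (hilb0_corank _ Hchar sF2 d2); lia.
  by rewrite (hilbS_corank Hchar sF2 d2 Hl1) ?l3E ?hilb_eq0; lia.
move=> P1 [P2 P3]; split; first by move=> _; apply: P1.
by split=> // re _ _; apply: P3.
Qed.
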